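(* For any dimension $d\ge0$, any measurable embedding $\phi_d:\mathcal X\times\mathcal Y\to\mathbb R^d$, any reward $r\in\mathcal R_d$, and any $\delta\in(0,\tfrac12)$, $$\mathcal L(r)-\mathcal L^\ast\ \ge\ 2e_d+\frac{\ell_\delta^2}{2}\,\bar P_d^\delta,$$ where $e_d=\mathbb E_{x\sim\nu}\mathbb E_{(y,y')\sim\mu_x^{\otimes2}}[(\bar p(x,y,y')-\tilde p_{\phi_d}(x,y,y'))^2]$ and $\ell_\delta=F^{-1}(\tfrac12+\delta)=\log\frac{1+2\delta}{1-2\delta}>0$.
   Context: $\mathcal X$ (prompts) and $\mathcal Y$ (responses) are measurable spaces, $\nu$ is a probability measure on $\mathcal X$, and for each $x$, $\mu_x$ is a probability measure on $\mathcal Y$ (a probability kernel in $x$). There are $n\ge1$ annotators with measurable utilities $u_i:\mathcal X\times\mathcal Y\to\mathbb R$. Let $F(t)=1/(1+e^{-t})$ and $\bar p(x,y,y')=\frac1n\sum_{i=1}^nF(u_i(x,y)-u_i(x,y'))$. $\tilde p_{\phi_d}(x,y,y')=\mathbb E_{(y_0,y_0')\sim\mu_x^{\otimes2}}[\bar p(x,y_0,y_0')\mid\phi_d(x,y_0)=\phi_d(x,y),\ \phi_d(x,y_0')=\phi_d(x,y')]$, i.e. for each $x$ the conditional expectation under $\mu_x^{\otimes2}$ given the pair of embedded values. For a reward $r$, $\Delta r(x,y,y')=r(x,y)-r(x,y')$, $\mathcal L(r)=\mathbb E_{x\sim\nu}\mathbb E_{(y,y')\sim\mu_x^{\otimes2}}[-\bar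 p\log F(\Delta r)-(1-\bar p)\log(1-F(\Delta r))]$, and $\mathcal L^\ast=\mathbb E_{x\sim\nu}\mathbb E_{(y,y')\sim\mu_x^{\otimes2}}[-\bar p\log\bar p-(1-\bar p)\log(1-\bar p)]$ is the Bayes-optimal loss. Feasibility class: with $\eta_d(x,y,y')=\min\{\tilde p_{\phi_d}(x,y,y'),1-\tilde p_{\phi_d}(x,y,y')\}$, $\mathcal R_d$ is the set of rewards of the form $(x,y)\mapsto g(\phi_d(x,y))$ ($g:\mathbb R^d\to\mathbb R$ measurable) such that $F(g(\phi_d(x,y))-g(\phi_d(x,y')))\in[\eta_d(x,y,y'),1-\eta_d(x,y,y')]$ for all $(x,y,y')$. Curvature weights: $\kappa_d=\eta_d(1-\eta_d)$ and $\kappa_d^{\min}(x,y_1,y_2,y_3)=\min\{\kappa_d(x,y_1,y_2),\kappa_d(x,y_2,y_3),\kappa_d(x,y_3,y_1)\}$. $\delta$-Condorcet cycles: a triplet $(y_1,y_2,y_3)$ is a positive $\delta$-Condorcet cycle under $\phi_d$ at $x$ if $\tilde p_{\phi_d}(x,y_1,y_2),\tilde p_{\phi_d}(x,y_2,y_3),\tilde p_{\phi_d}(x,y_3,y_1)$ are all $\ge\frac12+\delta$, and a negative one if all three are $\le\frac12-\delta$. $\mathcal{CC}_d^\delta$ is the union of these two events, and $$\bar P_d^\delta=\mathbb E_{x\sim\nu}\mathbb E_{(y_1,y_2,y_3)\sim\mu_x^{\otimes3}}\bigl[\kappa_d^{\min}(x,y_1,y_2,y_3)\,\mathbf 1_{\mathcal{CC}_d^\delta}(x,y_1,y_2,y_3)\bigr].$$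 *)

(* Defs.v *)
From HB Require Import structures.
From mathcomp Require Import all_boot all_order all_algebra.
From mathcomp Require Import all_classical all_reals all_analysis.

Set Implicit Arguments.
Unset Strict Implicit.
Unset Printing Implicit Defensive.

Import Order.TTheory GRing.Theory Num.Theory.
Import numFieldNormedType.Exports.

Local Open Scope classical_set_scope.
Local Open Scope ring_scope.

Section Logistic.
Context {R : realType}.
Implicit Types t p q delta : R.

Definition logistic t : R := (1 + expR (- t))^-1.

Definition cross_entropy p q : R := - p * ln q - (1 - p) * ln (1 - q).

Definition ell delta : R := ln ((1 + 2 * delta) / (1 - 2 * delta)).

End Logistic.

(* [g] is a version of the conditional expectation of [f] given the random
   element [Z], under the probability measure [P]. *)
Definition is_cond_expectation {d d'} {T : measurableType d}
    {T' : measurableType d'} {R : realType} (P : probability T R)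
    (Z : T -> T') (f g : T -> R) : Prop :=
  [/\ measurable_fun [set: g_sigma_algebra_preimageType Z] g,
      P.-integrable [set: T] (EFin \o g) &
      forall A, g_sigma_algebra_preimage Z A ->
        \int[P]_(t in A) (g t)%:E = \int[P]_(t in A) (f t)%:E ]%E.

Section KernelAt.
Context {dX dY} {X : measurableType dX} {Y : measurableType dY} {R : realType}.
Variables (mu : R.-pker X ~> Y) (x : X).

(* The kernel structure does not equip [mu x] with its [probability] instance,
   which is needed to form product probabilities. *)
Definition response : set Y -> \bar R := mu x.

HB.instance Definition _ := Measure.on response.
HB.instance Definition _ :=
  Measure_isProbability.Build _ _ _ response (prob_kernel x).

Definition response2 : probability (Y * Y)%type R := (response \x response)%E.
Definition response3 : probability (Y * Y * Y)%type R :=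
  (response2 \x response)%E.

End KernelAt.

Section Alignment.
Context {dX dY} {X : measurableType dX} {Y : measurableType dY} {R : realType}.
Variables (nu : probability X R) (mu : R.-pker X ~> Y).

Definition expect2 (f : X -> Y -> Y -> R) : \bar R :=
  (\int[nu]_x \int[response2 mu x]_z (f x z.1 z.2)%:E)%E.

Definition expect3 (f : X -> Y -> Y -> Y -> R) : \bar R :=
  (\int[nu]_x \int[response3 mu x]_z (f x z.1.1 z.1.2 z.2)%:E)%E.

Definition pbar {n} (u : 'I_n -> X * Y -> R) (x : X) (y y' : Y) : R :=
  n%:R^-1 * \sum_(i < n) logistic (u i (x, y) - u i (x, y')).

Definition gap (r : X * Y -> R) (x : X) (y y' : Y) : R := r (x, y) - r (x, y').

(* The integrand is nonnegative but [loss] may be [+oo]. *)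
Definition loss {n} (u : 'I_n -> X * Y -> R) (r : X * Y -> R) : \bar R :=
  expect2 (fun x y y' => cross_entropy (pbar u x y y') (logistic (gap r x y y'))).

Definition bayes_loss {n} (u : 'I_n -> X * Y -> R) : \bar R :=
  expect2 (fun x y y' => cross_entropy (pbar u x y y') (pbar u x y y')).

Section Embedding.
Context {d : nat}.
Variable phi : X * Y -> d.-tuple R.

(* Conditional expectations are only determined up to null sets: [pt] is a
   jointly measurable choice of a version at every prompt [x]. *)
Definition is_ptilde {n} (u : 'I_n -> X * Y -> R) (pt : X -> Y -> Y -> R) : Prop :=
  measurable_fun [set: X * Y * Y] (fun t => pt t.1.1 t.1.2 t.2) /\
  forall x, is_cond_expectation (response2 mu x)
    (fun z : Y * Y => (phi (x, z.1), phi (x, z.2)))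
    (fun z => pbar u x z.1 z.2) (fun z => pt x z.1 z.2).

Variable pt : X -> Y -> Y -> R.

Definition eta (x : X) (y y' : Y) : R := Num.min (pt x y y') (1 - pt x y y').

Definition feasible (r : X * Y -> R) : Prop :=
  exists g : d.-tuple R -> R,
    [/\ measurable_fun [set: d.-tuple R] g,
        forall x y, r (x, y) = g (phi (x, y)) &
        forall x y y', eta x y y'
          <= logistic (g (phi (x, y)) - g (phi (x, y')))
          <= 1 - eta x y y' ].

Definition kappa (x : X) (y y' : Y) : R := eta x y y' * (1 - eta x y y').

Definition kappa_min (x : X) (y1 y2 y3 : Y) : R :=
  Num.min (kappa x y1 y2) (Num.min (kappa x y2 y3) (kappa x y3 y1)).

Definition positive_cycle (delta : R) (x : X) (y1 y2 y3 : Y) : Prop :=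
  [/\ 2^-1 + delta <= pt x y1 y2, 2^-1 + delta <= pt x y2 y3 &
      2^-1 + delta <= pt x y3 y1].

Definition negative_cycle (delta : R) (x : X) (y1 y2 y3 : Y) : Prop :=
  [/\ pt x y1 y2 <= 2^-1 - delta, pt x y2 y3 <= 2^-1 - delta &
      pt x y3 y1 <= 2^-1 - delta].

Definition condorcet_cycles (delta : R) : set (X * Y * Y * Y) :=
  [set t | positive_cycle delta t.1.1.1 t.1.1.2 t.1.2 t.2] `|`
  [set t | negative_cycle delta t.1.1.1 t.1.1.2 t.1.2 t.2].

Definition cycle_mass (delta : R) : \bar R :=
  expect3 (fun x y1 y2 y3 =>
    kappa_min x y1 y2 y3 * \1_(condorcet_cycles delta) (x, y1, y2, y3)).

Definition embedding_error {n} (u : 'I_n -> X * Y -> R) : \bar R :=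
  expect2 (fun x y y' => (pbar u x y y' - pt x y y') ^+ 2).

End Embedding.

End Alignment.

(* Main.v *)
Require Import Defs.
From HB Require Import structures.
From mathcomp Require Import all_boot all_order all_algebra.
From mathcomp Require Import all_classical all_reals all_analysis.
From mathcomp Require Import measurable_realfun ring lra.

Set Implicit Arguments.
Unset Strict Implicit.
Unset Printing Implicit Defensive.

Import Order.TTheory GRing.Theory Num.Theory.
Import numFieldNormedType.Exports.

Local Open Scope classical_set_scope.
Local Open Scope ring_scope.

(* Write [P] for [pbar], [p] for [pt], [l = logit p] and [s] for the reward gap.
   The excess loss [KL(P || F s)] splits as
   [KL(P || p) + KL(p || F s) + (P - p) (l - s)].  Pinsker's inequality bounds the
   first term by [2 (P - p)^2]; the second is a Bregman divergence of the
   softplus function and feasibility keeps its second derivative above [kappa]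
   between [l] and [s], so it is at least [kappa / 2 * (l - s)^2]; the third
   integrates to zero because [l - s] depends only on the embedded responses.
   Along a cycle the gaps [s] sum to zero while the logits [l] sum to at least
   [3 ell] in absolute value, so by Cauchy-Schwarz the three values of
   [kappa (l - s)^2] sum to at least [3 ell^2 kappa_min]. *)

(** * Convexity estimates for the logistic function and the Bernoulli cross-entropy *)

Section Bernoulli.
Context {R : realType}.
Implicit Types a b c m p q s t : R.

(** The endpoints may come in either order, as a logit and a reward gap do; when [b < a], the
    identity on the reversed segment is negated on both sides. *)
Lemma mean_value_between (f df : R -> R) a b :
  (forall c, Num.min a b <= c <= Num.max a b -> is_derive c 1 f (df c)) ->
  exists2 c, Num.min a b <= c <= Num.max a b & f b - f a = df c * (b - a).
Proof.
have aux u v : u <= v -> (forall c, u <= c <= v -> is_derive c 1 f (df c)) ->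
    exists2 c, u <= c <= v & f v - f u = df c * (v - u).
  move=> uv fdf; have [c||c] := @MVT_segment R f df u v uv.
  - by rewrite in_itv/= => /andP[/ltW uc /ltW cv]; apply: fdf; rewrite uc.
  - apply: derivable_within_continuous => c; rewrite in_itv/= => /fdf.
    by move=> -[].
  - by rewrite in_itv/= => cuv E; exists c.
have [ab|ba] := leP a b; first exact: aux.
move=> fdf; have [c cab E] := aux b a (ltW ba) fdf; exists c => //.
by rewrite -[LHS]opprB E -mulrN opprB.
Qed.

(** The mean value theorem is used twice: for the remainder [g] between [a] and [b], giving [c],
    then for [df] between [a] and [c], giving [e]. Hence [g b - g a] is
    [(ddf e - m) * ((c - a) * (b - a))], where [c - a] and [b - a] never have opposite signs. *)
Lemma taylor2_lower_bound (f df ddf : R -> R) m a b :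
  (forall c, Num.min a b <= c <= Num.max a b ->
    [/\ is_derive c 1 f (df c), is_derive c 1 df (ddf c) & m <= ddf c]) ->
  f a + df a * (b - a) + m / 2 * (b - a) ^+ 2 <= f b.
Proof.
move=> H.
pose g t := f t - df a * t - m / 2 * (t - a) ^+ 2.
have [|c cab gE] := @mean_value_between g (fun t => df t - df a - m * (t - a)) a b.
  move=> c /H[fc _ _].
  rewrite /g; apply: is_derive_eq.
  by rewrite /GRing.scale/=; field.
have [|e eac dfE] := @mean_value_between df ddf a c.
  move=> e ec; have [] // := H e.
  move: cab ec; rewrite !ge_min !le_max.
  by case: (leP a b); case: (leP a c); lra.
have [_ _ me] : [/\ is_derive e 1 f (df e), is_derive e 1 df (ddf e) & m <= ddf e].
  apply: H; move: cab eac; rewrite !ge_min !le_max.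
  by case: (leP a b); case: (leP a c); lra.
have : 0 <= (ddf e - m) * ((c - a) * (b - a)).
  rewrite mulr_ge0 ?subr_ge0//.
  move: cab; case: (leP a b) => ab; nra.
have -> : (ddf e - m) * ((c - a) * (b - a)) = g b - g a.
  rewrite gE dfE; ring.
rewrite /g; lra.
Qed.

Lemma logistic_gt0 t : 0 < logistic t.
Proof. by rewrite invr_gt0 addr_gt0// expR_gt0. Qed.

Lemma logistic_lt1 t : logistic t < 1.
Proof. by rewrite invf_lt1 ?ltrDl ?expR_gt0// addr_gt0// expR_gt0. Qed.

Definition logit p := ln p - ln (1 - p).

Lemma logitK p : 0 < p < 1 -> logistic (logit p) = p.
Proof.
move=> /andP[p0 p1]; have q0 : 0 < 1 - p by lra.
rewrite /logistic /logit opprB expRD expRN !lnK ?posrE//.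
field; lra.
Qed.

Lemma le_logit : {in [pred p | 0 < p < 1] &, {homo logit : p q / p <= q}}.
Proof.
move=> p q; rewrite !inE => /andP[p0 p1] /andP[q0 q1] pq.
rewrite /logit lerB// ler_ln ?posrE//; lra.
Qed.

Lemma ler_logistic : {mono (@logistic R) : s t / s <= t}.
Proof.
move=> s t; rewrite /logistic lef_pV2 ?posrE ?addr_gt0 ?expR_gt0//.
by rewrite lerD2l ler_expR lerN2.
Qed.

Lemma logisticK t : logit (logistic t) = t.
Proof.
apply: (inc_inj ler_logistic).
by rewrite logitK ?logistic_gt0 ?logistic_lt1.
Qed.

Lemma ell_logit (delta : R) : 0 < delta -> delta < 2^-1 ->
  ell delta = logit (2^-1 + delta).
Proof.
move=> d0 d1; rewrite /ell /logit -ln_div ?posrE; last 2 first.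
- by lra.
- by lra.
congr ln; field; lra.
Qed.

Lemma logitN p : logit (1 - p) = - logit p.
Proof. by rewrite /logit subKr opprB. Qed.

Lemma logit_half : logit 2^-1 = 0.
Proof. by rewrite /logit; apply/eqP; rewrite subr_eq0; apply/eqP; congr ln; lra. Qed.

Lemma cross_entropy_ge0 p q : 0 <= p <= 1 -> 0 < q < 1 ->
  0 <= cross_entropy p q.
Proof.
move=> /andP[p0 p1] /andP[q0 q1].
have lq : ln q <= 0 by rewrite ln_le0// ltW.
have l1q : ln (1 - q) <= 0 by rewrite ln_le0//; lra.
by rewrite /cross_entropy; nra.
Qed.

Definition softplus t := ln (1 + expR t).

Lemma is_derive_softplus t : is_derive t 1 softplus (logistic t).
Proof.
have e0 : 0 < 1 + expR t by rewrite addr_gt0// expR_gt0.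
have ln' := is_derive1_ln e0.
rewrite /softplus; apply: is_derive_eq.
rewrite /logistic expRN /GRing.scale/=.
by have := expR_gt0 t; move=> h; field; lra.
Qed.

Lemma is_derive_logistic t :
  is_derive t 1 (@logistic R) (logistic t * (1 - logistic t)).
Proof.
have e0 : 0 < 1 + expR (- t) by rewrite addr_gt0// expR_gt0.
have ne0 := lt0r_neq0 e0.
rewrite /logistic; apply: is_derive_eq.
by rewrite /GRing.scale/=; field; lra.
Qed.

(** In the logit variable the cross-entropy is convex in [t] and affine in [p]. Affinity is what
    leaves a single cross term when one target probability is exchanged for another. *)
Lemma cross_entropy_logistic p t :
  cross_entropy p (logistic t) = softplus t - p * t.
Proof.
have e0 : 0 < 1 + expR t by rewrite addr_gt0// expR_gt0.
have E : 1 - logistic t = (1 + expR t)^-1.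
  by rewrite /logistic expRN; have := expR_gt0 t => h; field; lra.
have F : logistic t = expR t / (1 + expR t).
  by rewrite /logistic expRN; have := expR_gt0 t => h; field; lra.
rewrite /cross_entropy E F lnV ?posrE// ln_div ?posrE ?expR_gt0// expRK.
rewrite /softplus; ring.
Qed.

(* The Bregman divergence of [softplus], whose second derivative is
   [F (1 - F)]. *)
Lemma softplus_strongly_convex (k : R) (s t : R) :
  (forall c, Num.min s t <= c <= Num.max s t ->
    k <= logistic c * (1 - logistic c)) ->
  softplus s + logistic s * (t - s) + k / 2 * (t - s) ^+ 2 <= softplus t.
Proof.
move=> kF; apply: (@taylor2_lower_bound softplus (@logistic R)
  (fun t => logistic t * (1 - logistic t))) => c /kF kc; split => //.
- exact: is_derive_softplus.
- exact: is_derive_logistic.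
Qed.

(** The negative entropy [f] has derivative [logit] and second derivative [1 / (c (1 - c)) >= 4];
    its second-order expansion at [q] is the claim, with [2 = 4 / 2]. *)
Lemma pinsker_bernoulli p q : 0 < p < 1 -> 0 < q < 1 ->
  cross_entropy p p + 2 * (p - q) ^+ 2 <= cross_entropy p q.
Proof.
move=> p01 q01.
pose f t := t * ln t + (1 - t) * ln (1 - t).
have := @taylor2_lower_bound f logit (fun t => t^-1 + (1 - t)^-1) 4 q p.
move=> /(_ _)/wrap[c cpq|].
  have /andP[c0 c1] : 0 < c < 1.
    by move: cpq p01 q01; rewrite ge_min le_max; lra.
  have c1' : 0 < 1 - c by lra.
  have ln1 := is_derive1_ln c0.
  have ln2 := is_derive1_ln c1'.
  split.
  - rewrite /f; apply: is_derive_eq.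
    rewrite /GRing.scale/= /logit; field; lra.
  - rewrite /logit; apply: is_derive_eq.
    rewrite /GRing.scale/=; field; lra.
  - rewrite -subr_ge0.
    have -> : c^-1 + (1 - c)^-1 - 4 = (1 - 2 * c) ^+ 2 / (c * (1 - c)).
      by field; lra.
    by rewrite divr_ge0 ?sqr_ge0// mulr_ge0 ?ltW.
rewrite /f /logit /cross_entropy; lra.
Qed.

End Bernoulli.

(** Pinsker's inequality for [P] and [p] is added to the strong convexity of [softplus] from
    [logit p] to [s]. The cross term appears because the tangent slope at [logit p] is [p] while the
    target is [P]. *)
Lemma loss_gap_lower_bound (R : realType) (P p s : R) :
  0 < P < 1 -> 0 < p < 1 ->
  Num.min p (1 - p) <= logistic s <= 1 - Num.min p (1 - p) ->
  cross_entropy P P + 2 * (P - p) ^+ 2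
    + Num.min p (1 - p) * (1 - Num.min p (1 - p)) / 2 * (logit p - s) ^+ 2
    + (P - p) * (logit p - s) <= cross_entropy P (logistic s).
Proof.
move=> P01 p01; set e := Num.min p (1 - p) => sE.
have pE : e <= logistic (logit p) <= 1 - e.
  rewrite logitK//; have [] : e <= p /\ e <= 1 - p by rewrite /e !ge_min !lexx orbT.
  by move=> ep e1p; apply/andP; split; lra.
have := pinsker_bernoulli P01 p01.
clearbody e.
rewrite -{2}(logitK p01) !cross_entropy_logistic.
have /(_ _)/wrap[|] := @softplus_strongly_convex _ (e * (1 - e)) (logit p) s.
  move=> c cE.
  (* Both ends of the segment have logistic value in [[e, 1 - e]], hence so does [c] by
     monotonicity, and [q (1 - q) >= e (1 - e)] on that interval. *)
  have : e <= logistic c <= 1 - e.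
    move: cE pE sE; case: (leP (logit p) s) => _ /andP[c1 c2];
      move: c1 c2; rewrite -ler_logistic => c1; rewrite -ler_logistic => c2;
      move=> /andP[p1 p2] /andP[s1 s2].
      by rewrite (le_trans p1 c1) (le_trans c2 s2).
    by rewrite (le_trans s1 c1) (le_trans c2 p2).
  move=> /andP[ec ce]; rewrite -subr_ge0.
  have -> : logistic c * (1 - logistic c) - e * (1 - e) =
    (logistic c - e) * (1 - e - logistic c) by ring.
  by rewrite mulr_ge0// subr_ge0.
rewrite logitK// ; move: (logistic s) (logit p) => q l H1 H2; lra.
Qed.

(** * Comparison and vanishing of integrals *)

Section Integration.
Local Open Scope ereal_scope.
Context d (T : measurableType d) (R : realType).

(* The integral of a nonnegative function is a supremum over the simple
   functions below it, so no measurability is needed. *)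
Lemma le_integral_ge0 (mu : {measure set T -> \bar R}) (f g : T -> \bar R) :
  (forall x, f x <= g x) -> (forall x, 0 <= g x) ->
  \int[mu]_x f x <= \int[mu]_x g x.
Proof.
move=> fg g0; rewrite integralE.
apply: (@le_trans _ _ (\int[mu]_x f^\+ x)).
  by rewrite geeDl// oppe_le0 integral_ge0.
rewrite !ge0_integralTE//; apply: le_ereal_sup => _ [h hf <-].
exists h => // x; rewrite (le_trans (hf x))// funeposE.
by rewrite ge_max fg g0.
Qed.

(** The integral of [|f|] over [A] vanishes, so [f] is zero almost everywhere on [A]; since [f] is
    never zero, the exceptional null set contains [A]. *)
Lemma measure0_of_integral_le0 (mu : {measure set T -> \bar R}) (A : set T)
    (f : T -> R) :
  measurable A -> measurable_fun setT f -> (forall x, 0 < f x)%R ->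
  \int[mu]_(x in A) (f x)%:E <= 0 -> mu A = 0.
Proof.
move=> mA mf f0 intf0.
have mfA : measurable_fun A (EFin \o f).
  by apply: measurable_funTS; exact/measurable_EFinP.
have /ae_eq_integral_abs : \int[mu]_(x in A) `|(EFin \o f) x| = 0.
  apply/eqP; rewrite eq_le integral_ge0// andbT.
  apply: le_trans intf0; rewrite le_eqVlt; apply/orP; left; apply/eqP.
  by apply: eq_integral => x _ /=; rewrite gtr0_norm.
move=> /(_ mA mfA)[N [mN N0 AN]].
apply: (subset_measure0 mA mN _ N0) => x Ax; apply: AN => /=.
by move=> /(_ Ax)[/eqP]; rewrite gt_eqF.
Qed.

End Integration.

(** * The sigma-algebra generated by [Z]: pull-out property and range of versions *)

Section SubSigmaAlgebra.
Local Open Scope ereal_scope.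
Context d d' (T : measurableType d) (T' : measurableType d') (R : realType).
Variables (P : probability T R) (Z : T -> T').
Hypothesis mZ : measurable_fun [set: T] Z.
Local Notation G := (g_sigma_algebra_preimageType Z).

Lemma sub_measurable (A : set T) : measurable (A : set G) -> measurable A.
Proof. by move=> [B mB <-]; exact: mZ. Qed.

Lemma sub_measurable_fun d'' (S : measurableType d'') (h : T -> S) :
  measurable_fun [set: G] h -> measurable_fun [set: T] h.
Proof. by move=> mh _ B mB; apply: sub_measurable; exact: mh. Qed.

Import HBNNSimple.

Section pull_out.
Variables f g : T -> R.
Hypotheses (mf : measurable_fun [set: T] f) (mg : measurable_fun [set: T] g).
Hypotheses (f0 : forall x, (0 <= f x)%R) (g0 : forall x, (0 <= g x)%R).
Hypothesis fg : forall A : set T, measurable (A : set G) ->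
  \int[P]_(x in A) (f x)%:E = \int[P]_(x in A) (g x)%:E.

(** The level sets of [h] belong to the sigma-algebra of [Z], so in this form the integral depends
    on [k] only through its integrals over events of that sigma-algebra. *)
Lemma integral_mul_nnsfun (k : T -> R) (h : {nnsfun G >-> R}) :
  measurable_fun [set: T] k -> (forall x, (0 <= k x)%R) ->
  \int[P]_x (k x * h x)%:E =
  \sum_(r \in range h) r%:E * \int[P]_(x in h @^-1` [set r]) (k x)%:E.
Proof.
move=> mk k0.
have mA r : measurable (h @^-1` [set r] : set T).
  by apply: sub_measurable; exact: (measurable_funPTI h).
transitivity (\int[P]_x
    (\sum_(r \in range h) (k x * (r * \1_(h @^-1` [set r]) x))%:E)).
  apply: eq_integral => x _; rewrite fsumEFin// -mulr_fsumr.
  by rewrite [in LHS](fimfunE h x).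
rewrite ge0_integral_fsum//; last first.
- by move=> r x _; rewrite lee_fin mulr_ge0// -lee_fin nnfun_muleindic_ge0.
- move=> r; apply/measurable_EFinP; apply: measurable_funM => //.
  exact: measurable_funM.
apply: eq_fsbigr => r; rewrite inE => -[y _ <-].
rewrite [in RHS]integral_mkcond -ge0_integralZl//; last 2 first.
- by move=> x _; apply: erestrict_ge0 => z _; rewrite lee_fin.
- by rewrite lee_fin.
- apply: eq_integral => x _; rewrite patchE indicE.
  by case: ifPn => _; rewrite ?mulr1 ?mulr0 ?mule0// -EFinM mulrC.
- apply/(measurable_restrictT _ _).1 => //.
  by apply: measurable_funTS; exact/measurable_EFinP.
Qed.

(** For simple functions of the sigma-algebra of [Z] the two sides agree level set by level set;
    monotone convergence extends this to [h]. *)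
Lemma integral_mul_sub_measurable (h : T -> R) :
  measurable_fun [set: G] h -> (forall x, (0 <= h x)%R) ->
  \int[P]_x (f x * h x)%:E = \int[P]_x (g x * h x)%:E.
Proof.
move=> mh h0.
have mEh : measurable_fun [set: G] (EFin \o h) by exact/measurable_EFinP.
pose h_ := nnsfun_approx measurableT mEh.
have cvgh (k : T -> R) : measurable_fun [set: T] k ->
    (forall x, (0 <= k x)%R) ->
    \int[P]_x (k x * h_ n x)%:E @[n --> \oo] --> \int[P]_x (k x * h x)%:E.
  move=> mk k0.
  have E : \int[P]_x (k x * h x)%:E =
      \int[P]_x (limn (fun n => (k x * h_ n x)%:E)).
    apply: eq_integral => x _; apply/esym/cvg_lim => //.
    under eq_fun do rewrite EFinM.
    rewrite EFinM; apply: cvgeZl => //.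
    by apply: (cvg_nnsfun_approx measurableT mEh) => // y _; rewrite lee_fin.
  rewrite E; apply: cvg_monotone_convergence => //.
  - move=> n; apply/measurable_EFinP; apply: measurable_funM => //.
    by apply: sub_measurable_fun; exact: measurable_funP.
  - by move=> n x _; rewrite lee_fin mulr_ge0.
  - move=> x _ m n mn; rewrite lee_fin ler_wpM2l//.
    by have /lefP := nd_nnsfun_approx measurableT mEh mn; exact.
have := cvgh f mf f0; have := cvgh g mg g0.
rewrite (_ : (fun n => \int[P]_x (g x * h_ n x)%:E) =
             (fun n => \int[P]_x (f x * h_ n x)%:E)); last first.
  apply/funext => n; rewrite !integral_mul_nnsfun//.
  by apply: eq_fsbigr => r _; rewrite fg.
by move=> cg cf; exact: (cvg_unique _ cf cg).
Qed.

End pull_out.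

Section versions.
Variables f g : T -> R.
Hypotheses (mf : measurable_fun [set: T] f) (f01 : forall x, (0 < f x < 1)%R).
Hypothesis fg : is_cond_expectation P Z f g.

(** The events [g <= 0] and [1 <= g] belong to the sigma-algebra of [Z], so [f] and [g] have equal
    integrals over them; as [f > 0] and [1 - f > 0], both are null. *)
Lemma cond_expectation_itv01 :
  exists N : set T, [/\ measurable N, P N = 0 &
    ~` N = [set x | 0 < g x < 1]%R].
Proof.
have [mg _ fgE] := fg.
have mg' : measurable_fun [set: T] g by exact: sub_measurable_fun.
have f0 x : (0 < f x)%R by case/andP: (f01 x).
have f1 x : (0 < 1 - f x)%R by rewrite subr_gt0; case/andP: (f01 x).
pose N0 := [set x | g x <= 0]%R; pose N1 := [set x | 1 <= g x]%R.
have mN0G : measurable (N0 : set G).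
  rewrite (_ : N0 = [set: G] `&` g @^-1` `]-oo, 0%R]); first exact: mg.
  by rewrite setTI; apply/seteqP; split => x /=; rewrite in_itv.
have mN1G : measurable (N1 : set G).
  rewrite (_ : N1 = [set: G] `&` g @^-1` `[1%R, +oo[); first exact: mg.
  by rewrite setTI; apply/seteqP; split => x /=; rewrite in_itv/= andbT.
have mN0 := sub_measurable mN0G; have mN1 := sub_measurable mN1G.
have P0 : P N0 = 0.
  apply: (measure0_of_integral_le0 mN0 mf f0); rewrite -fgE//.
  rewrite integral_mkcond -(integral0 P setT).
  apply: le_integral_ge0 => // x; rewrite patchE; case: ifPn => //.
  by rewrite inE lee_fin.
have P1 : P N1 = 0.
  apply: (measure0_of_integral_le0 mN1 _ f1).
    exact: measurable_funB.
  have E : \int[P]_(x in N1) (1 - f x)%:E + \int[P]_(x in N1) (f x)%:E = P N1.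
    rewrite -ge0_integralD//.
    - under eq_integral do rewrite -EFinD subrK.
      by rewrite integral_cst// mul1e.
    - by move=> x _; rewrite lee_fin ltW.
    - by apply: measurable_funTS; apply/measurable_EFinP; exact: measurable_funB.
    - by move=> x _; rewrite lee_fin ltW.
    - by apply: measurable_funTS; apply/measurable_EFinP.
  have fle : P N1 <= \int[P]_(x in N1) (f x)%:E.
    rewrite -fgE// -[leLHS]mul1e -integral_cst//.
    apply: ge0_le_integral => //.
    - by apply: measurable_funTS; apply/measurable_EFinP.
  (* Finiteness allows the integral of [f] to be cancelled between [E] and [fle]. *)
  have fin : \int[P]_(x in N1) (f x)%:E \is a fin_num.
    rewrite ge0_fin_numE ?integral_ge0//; last first.
      by move=> x _; rewrite lee_fin ltW.
    apply: (@le_lt_trans _ _ (P N1)); last by rewrite ltey_eq fin_num_measure.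
    rewrite -E leeDr// integral_ge0// => x _; rewrite lee_fin ltW//.
  by rewrite -(leeD2rE _ _ fin) add0e E.
exists (N0 `|` N1); split; first exact: measurableU.
  exact: null_set_setU.
apply/seteqP; split => x /=; rewrite /N0 /N1 /=.
  by move=> /not_orP[/negP + /negP]; rewrite -!ltNge => -> ->.
by move=> /andP[g0 g1] []; rewrite leNgt ?g0 ?g1.
Qed.

End versions.
End SubSigmaAlgebra.

(** * Comparison of integrals up to a term of zero conditional mean *)

Section ConditionalExpectation.
Local Open Scope ereal_scope.
Context d d' (T : measurableType d) (T' : measurableType d') (R : realType).
Variables (P : probability T R) (Z : T -> T').
Hypothesis mZ : measurable_fun [set: T] Z.
Local Notation G := (g_sigma_algebra_preimageType Z).
Variables f g : T -> R.
Hypotheses (mf : measurable_fun [set: T] f) (f01 : forall x, (0 < f x < 1)%R).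
Hypothesis fg : is_cond_expectation P Z f g.

(* Truncating to [0 < g < 1] and [|h| <= k], where the integral of
   [(f - g) h] vanishes, and letting [k] grow spares any integrability
   assumption on [h]. *)
Lemma le_integral_cond_expectation (B C h : T -> R) :
  measurable_fun [set: T] B -> measurable_fun [set: T] C ->
  measurable_fun [set: G] h ->
  (forall x, 0 <= B x)%R -> (forall x, 0 <= C x)%R ->
  (forall x, 0 < g x < 1 -> B x + (f x - g x) * h x <= C x)%R ->
  \int[P]_x (B x)%:E <= \int[P]_x (C x)%:E.
Proof.
move=> mB mC mh B0 C0 BC; have [mg _ fgE] := fg.
pose A k := [set x | 0 < g x < 1]%R `&` [set x | `|h x| <= k%:R]%R.
have mAG k : measurable (A k : set G).
  apply: measurableI.
    rewrite (_ : mkset _ = [set: G] `&` g @^-1` `]0%R, 1%R[); first exact: mg.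
    by rewrite setTI; apply/seteqP; split => x /=; rewrite in_itv.
  rewrite (_ : mkset _ = [set: G] `&` h @^-1` `[(- k%:R)%R, k%:R%R]).
    exact: mh.
  by rewrite setTI; apply/seteqP; split => x /=; rewrite in_itv/= ler_norml.
have mA k : measurable (A k) by exact: (sub_measurable mZ).
have mg' : measurable_fun [set: T] g by exact: (sub_measurable_fun mZ).
have mh' : measurable_fun [set: T] h by exact: (sub_measurable_fun mZ).
have patch_int (k : T -> R) (E : set T) D :
    \int[P]_(x in D) ((k \_ E) x)%:E = \int[P]_(x in D `&` E) (k x)%:E.
  rewrite integral_mkcondr; apply: eq_integral => x _.
  by rewrite !patchE; case: ifPn.
have leA k : \int[P]_(x in A k) (B x)%:E <= \int[P]_x (C x)%:E.
  apply: (@le_trans _ _ (\int[P]_(x in A k) (C x)%:E)); last first.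
    by apply: ge0_subset_integral => //; [exact/measurable_EFinP|
      move=> x _; rewrite lee_fin].
  have mpatch (q : T -> R) : measurable_fun [set: T] q ->
      measurable_fun [set: T] (q \_ (A k)).
    by move=> mq; apply/(measurable_restrictT _ _).1 => //; exact: measurable_funTS.
  (* Restriction to [A k] makes both functions nonnegative and keeps their integrals equal over
     events of the sigma-algebra of [Z], to which [A k] belongs. *)
  pose f1 := f \_ (A k); pose g1 := g \_ (A k).
  have mf1 : measurable_fun [set: T] f1 by exact: mpatch.
  have mg1 : measurable_fun [set: T] g1 by exact: mpatch.
  have f10 x : (0 <= f1 x)%R.
    by rewrite /f1 patchE; case: ifPn => // _; case/andP: (f01 x) => /ltW.
  have g10 x : (0 <= g1 x)%R.
    by rewrite /g1 patchE; case: ifPn => //; rewrite inE => -[/= /andP[/ltW]].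
  have fg1 (D : set T) : measurable (D : set G) ->
      \int[P]_(x in D) (f1 x)%:E = \int[P]_(x in D) (g1 x)%:E.
    by move=> mD; rewrite !patch_int fgE//; exact: (@measurableI _ G _ _ mD (mAG k)).
  (* The pull-out property is stated for nonnegative factors, so [h] is split as [hp - hn]. *)
  pose hp x := Num.max (h x) 0%R; pose hn x := Num.max (- h x)%R 0%R.
  have hp0 x : (0 <= hp x)%R by rewrite le_max lexx orbT.
  have hn0 x : (0 <= hn x)%R by rewrite le_max lexx orbT.
  have mhp : measurable_fun [set: G] hp by exact: measurable_maxr.
  have mhn : measurable_fun [set: G] hn.
    by apply: measurable_maxr => //; exact: measurable_funN.
  have mhp' := sub_measurable_fun mZ mhp; have mhn' := sub_measurable_fun mZ mhn.
  have Ep := integral_mul_sub_measurable mZ mf1 mg1 f10 g10 fg1 mhp hp0.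
  have En := integral_mul_sub_measurable mZ mf1 mg1 f10 g10 fg1 mhn hn0.
  have fin (q : T -> R) : measurable_fun [set: T] q -> (forall x, 0 <= q x)%R ->
      (forall x, q x <= `|h x|)%R -> \int[P]_x (f1 x * q x)%:E \is a fin_num.
    move=> mq q0 qh; rewrite ge0_fin_numE; last first.
      by apply: integral_ge0 => x _; rewrite lee_fin mulr_ge0.
    apply: (@le_lt_trans _ _ (\int[P]_x (cst k%:R%:E x))).
      apply: ge0_le_integral => //.
      - by move=> x _; rewrite lee_fin mulr_ge0.
      - by apply/measurable_EFinP; exact: measurable_funM.
      - move=> x _; rewrite lee_fin /f1 patchE; case: ifPn; last by rewrite mul0r.
        rewrite inE => -[_ /= hk]; apply: le_trans hk.
        apply: le_trans (qh x); rewrite ler_piMl//.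
        by case/andP: (f01 x) => _ /ltW.
    by rewrite integral_cst// ltey_eq fin_numM// fin_num_measure.
  have finp := fin hp mhp' hp0 _; have finn := fin hn mhn' hn0 _.
  have {}finp : \int[P]_x (f1 x * hp x)%:E \is a fin_num.
    by apply: finp => x; rewrite /hp ge_max ler_norm normr_ge0.
  have {}finn : \int[P]_x (f1 x * hn x)%:E \is a fin_num.
    by apply: finn => x; rewrite /hn ge_max -normrN ler_norm normr_ge0.
  rewrite -(setTI (A k)) -!patch_int.
  (* The cross term is inserted without subtraction: the finite integrals of [f1 hp] and [f1 hn] are
     added to both sides, then [f1 hn] becomes [g1 hn] on the left and [f1 hp] becomes [g1 hp] on
     the right. What remains is [BC] pointwise. *)
  rewrite -(leeD2rE _ _ finp) -(leeD2rE _ _ finn).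
  rewrite {1}En {2}Ep.
  have mEM (q1 q2 : T -> R) : measurable_fun [set: T] q1 ->
      measurable_fun [set: T] q2 ->
      measurable_fun [set: T] (fun x => (q1 x * q2 x)%:E).
    by move=> ? ?; apply/measurable_EFinP; exact: measurable_funM.
  have mEp (q : T -> R) : measurable_fun [set: T] q ->
      measurable_fun [set: T] (fun x => ((q \_ (A k)) x)%:E).
    by move=> ?; apply/measurable_EFinP; exact: mpatch.
  have p0 (q : T -> R) : (forall x, 0 <= q x)%R -> forall x, 0 <= ((q \_ (A k)) x)%:E.
    by move=> q0 x; rewrite patchE lee_fin; case: ifPn.
  have M0 (q1 q2 : T -> R) : (forall x, 0 <= q1 x)%R -> (forall x, 0 <= q2 x)%R ->
    forall x, 0 <= (q1 x * q2 x)%:E by move=> ? ? x; rewrite lee_fin mulr_ge0.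
  rewrite -!ge0_integralD//; try by
    [move=> x _; apply: p0 | move=> x _; apply: M0 | apply: mEp | apply: mEM
    | move=> x _; apply: adde_ge0; [apply: p0|apply: M0]
    | apply: emeasurable_funD; [apply: mEp|apply: mEM] ].
  apply: ge0_le_integral => //; try by
    [ move=> x _; apply: adde_ge0; [apply: adde_ge0; [apply: p0|apply: M0]|apply: M0]
    | apply: emeasurable_funD; [apply: emeasurable_funD; [apply: mEp|apply: mEM]|apply: mEM] ].
  move=> x _; rewrite -!EFinD lee_fin /f1 /g1 !patchE; case: ifPn => [|_]; last first.
    by rewrite !mul0r.
  rewrite inE => -[/= /BC + _].
  have -> : h x = (hp x - hn x)%R.
    by rewrite /hp /hn; case: (leP (h x) 0%R); case: (leP (- h x)%R 0%R); lra.
  lra.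
(* Off the null set [N] the increasing events [A k] exhaust the space, so [leA] passes to the limit
   in [k]. *)
have [N [mN N0 NE]] := cond_expectation_itv01 mZ mf f01 fg.
rewrite (ge0_negligible_integral mN)//; last 2 first.
- exact/measurable_EFinP.
- by move=> x _; rewrite lee_fin.
have -> : setT `\` N = \bigcup_k A k.
  rewrite setTD NE; apply/seteqP; split => x /=; last by case=> k _ [].
  move=> gx; exists (Num.trunc `|h x|).+1 => //; split => //=.
  exact/ltW/truncnS_gt.
have cvgA := @ge0_nondecreasing_set_cvg_integral _ _ _ A (EFin \o B) P.
have {cvgA} cvgA : \int[P]_(x in A k) (B x)%:E @[k --> \oo] -->
    \int[P]_(x in \bigcup_k A k) (B x)%:E.
  apply: cvgA => //.
  - move=> m n mn; apply/subsetPset => x [gx /= hm]; split => //=.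
    by rewrite (le_trans hm)// ler_nat.
  - by move=> k; apply: measurable_funTS; exact/measurable_EFinP.
  - by move=> k x _; rewrite lee_fin.
rewrite -(cvg_lim _ cvgA)//; apply: lime_le; first by apply/cvg_ex; eexists; exact: cvgA.
exact: nearW.
Qed.

End ConditionalExpectation.

(** * Product integrals of functions of one coordinate *)

Section Marginals.
Local Open Scope ereal_scope.
Context d1 d2 (T1 : measurableType d1) (T2 : measurableType d2) (R : realType).
Variables (m1 : probability T1 R) (m2 : probability T2 R).

Lemma ge0_integral_fst (q : T1 -> \bar R) : measurable_fun [set: T1] q ->
  (forall x, 0 <= q x) -> \int[m1 \x m2]_w q w.1 = \int[m1]_x q x.
Proof.
move=> mq q0; rewrite (fubini_tonelli1 (q \o fst))//=; last first.
  exact: measurableT_comp.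
apply: eq_integral => x _; rewrite /fubini_F/=.
by rewrite integral_cst// [X in _ * X]probability_setT mule1.
Qed.

Lemma ge0_integral_snd (q : T2 -> \bar R) : measurable_fun [set: T2] q ->
  (forall x, 0 <= q x) -> \int[m1 \x m2]_w q w.2 = \int[m2]_x q x.
Proof.
move=> mq q0; rewrite (fubini_tonelli2 (q \o snd))//=; last first.
  exact: measurableT_comp.
apply: eq_integral => x _; rewrite /fubini_G/=.
by rewrite integral_cst// [X in _ * X]probability_setT mule1.
Qed.

End Marginals.

(** * Integrals over pairs and triples of responses *)

Section ResponsePairs.
Local Open Scope ereal_scope.
Context {dX dY} {X : measurableType dX} {Y : measurableType dY} {R : realType}.
Variable mu : R.-pker X ~> Y.

(** Any two of three independent responses, in either order, are distributed as an independent pair,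
    so the three summands have the same integral. *)
Lemma integral_cycle_pairs (x : X) (q : Y * Y -> \bar R) :
  measurable_fun [set: Y * Y] q -> (forall z, 0 <= q z) ->
  \int[response3 mu x]_w (q w.1 + q (w.1.2, w.2) + q (w.2, w.1.1)) =
  3%:E * \int[response2 mu x]_z q z.
Proof.
move=> mq q0.
pose m := response mu x; pose mm := response2 mu x.
have m12 : measurable_fun [set: Y * Y * Y] (fun w : Y * Y * Y => q (w.1.2, w.2)).
  apply: measurableT_comp => //; apply: measurable_fun_pair => //.
  exact: measurableT_comp.
have m21 : measurable_fun [set: Y * Y * Y] (fun w : Y * Y * Y => q (w.2, w.1.1)).
  apply: measurableT_comp => //; apply: measurable_fun_pair => //.
  exact: measurableT_comp.
have m11 : measurable_fun [set: Y * Y * Y] (fun w : Y * Y * Y => q w.1).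
  exact: measurableT_comp.
rewrite ge0_integralD//; last 2 first.
- by move=> w _; exact: adde_ge0.
- exact: emeasurable_funD.
rewrite ge0_integralD//.
have -> : \int[response3 mu x]_w q w.1 = \int[mm]_z q z.
  exact: (@ge0_integral_fst _ _ _ _ _ mm m).
have -> : \int[response3 mu x]_w q (w.1.2, w.2) = \int[mm]_z q z.
  transitivity (\int[mm]_w \int[m]_y q (w.2, y)).
    exact: (@fubini_tonelli1 _ _ _ _ _ mm m (fun w => q (w.1.2, w.2))).
  transitivity (\int[m]_y \int[m]_y' q (y, y')); last first.
    by apply/esym; exact: (@fubini_tonelli1 _ _ _ _ _ m m q).
  apply: (@ge0_integral_snd _ _ _ _ _ m m (fun y => \int[m]_y' q (y, y'))).
    exact: (@measurable_fun_fubini_tonelli_F _ _ _ _ _ m q).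
  by move=> y; exact: integral_ge0.
(* The third coordinate is now the first argument of [q], so Tonelli's theorem is read in the
   opposite order of integration. *)
have -> : \int[response3 mu x]_w q (w.2, w.1.1) = \int[mm]_z q z.
  transitivity (\int[mm]_w \int[m]_y q (y, w.1)).
    exact: (@fubini_tonelli1 _ _ _ _ _ mm m (fun w => q (w.2, w.1.1))).
  transitivity (\int[m]_y \int[m]_y' q (y', y)); last first.
    by apply/esym; exact: (@fubini_tonelli2 _ _ _ _ _ m m q).
  apply: (@ge0_integral_fst _ _ _ _ _ m m (fun y => \int[m]_y' q (y', y))).
    exact: (@measurable_fun_fubini_tonelli_G _ _ _ _ _ m q).
  by move=> y; exact: integral_ge0.
have I0 : 0 <= \int[mm]_z q z by exact: integral_ge0.
have -> : 3%R = (1 + 1 + 1)%R :> R by ring.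
by rewrite !EFinD !ge0_muleDl ?mul1e// lee_fin.
Qed.

(** The pullback of [mu] along the first projection turns the integral over [y'] of a function of
    [(x, y, y')] into a kernel integral, hence a measurable function of [(x, y)]. *)
Definition kernel_fst (t : X * Y) : {measure set Y -> \bar R} := mu t.1.

Let measurable_kernel_fst U : measurable U ->
  measurable_fun [set: X * Y] (kernel_fst ^~ U).
Proof.
move=> mU; apply: (measurableT_comp (measurable_kernel mu U mU)).
exact: measurable_fst.
Qed.

HB.instance Definition _ := isKernel.Build _ _ _ _ _ kernel_fst
  measurable_kernel_fst.

HB.instance Definition _ := Kernel_isProbability.Build _ _ _ _ _
  kernel_fst (fun t => prob_kernel t.1).

Lemma measurable_integral_response2 (f : X * Y * Y -> \bar R) :
  measurable_fun [set: X * Y * Y] f -> (forall t, 0 <= f t) ->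
  measurable_fun [set: X] (fun x => \int[response2 mu x]_z f (x, z.1, z.2)).
Proof.
move=> mf f0.
rewrite (_ : (fun x => _) = (fun x => \int[mu x]_y \int[mu x]_y' f (x, y, y'))).
  apply: (measurable_fun_integral_finite_kernel
    (fun t => \int[kernel_fst t]_y' f (t, y')) mu).
    by move=> t; exact: integral_ge0.
  exact: measurable_fun_integral_finite_kernel.
apply/funext => x.
apply: (@fubini_tonelli1 _ _ _ _ _ (response mu x) (response mu x)
  (fun z => f (x, z.1, z.2))) => //.
apply: measurableT_comp => //; apply: measurable_fun_pair => //.
exact: measurable_fun_pair.
Qed.

End ResponsePairs.

(** This is Cauchy-Schwarz: [3 (a1^2 + a2^2 + a3^2) - (a1 + a2 + a3)^2] is the sum of the squared
    pairwise differences. *)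
Lemma sum_sqr_cycle (R : realFieldType) (k k1 k2 k3 a1 a2 a3 l : R) :
  0 <= k -> k <= k1 -> k <= k2 -> k <= k3 ->
  (3 * l) ^+ 2 <= (a1 + a2 + a3) ^+ 2 ->
  3 * l ^+ 2 * k <= k1 * a1 ^+ 2 + k2 * a2 ^+ 2 + k3 * a3 ^+ 2.
Proof.
move=> k0 kk1 kk2 kk3 la.
have /(ler_wpM2l k0) : 3 * l ^+ 2 <= a1 ^+ 2 + a2 ^+ 2 + a3 ^+ 2.
  have := sqr_ge0 (a1 - a2); have := sqr_ge0 (a2 - a3).
  by have := sqr_ge0 (a3 - a1); lra.
have := ler_wpM2r (sqr_ge0 a1) kk1; have := ler_wpM2r (sqr_ge0 a2) kk2.
by have := ler_wpM2r (sqr_ge0 a3) kk3; lra.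
Qed.

(** * The pointwise bound along Condorcet cycles *)

Section Pointwise.
Context {dX dY} {X : measurableType dX} {Y : measurableType dY} {R : realType}.
Variables (pt : X -> Y -> Y -> R) (r : X * Y -> R).

(* Clipping [kappa] at [0] discards the arguments where the version [pt] of the
   conditional expectation leaves [(0, 1)]. *)
Definition logit_error (x : X) (y y' : Y) : R :=
  Num.max (kappa pt x y y') 0 * (logit (pt x y y') - gap r x y y') ^+ 2.

Lemma logit_error_ge0 x y y' : 0 <= logit_error x y y'.
Proof. by rewrite mulr_ge0 ?sqr_ge0// le_max lexx orbT. Qed.

(** Whichever of [p] and [1 - p] is the minimum, [kappa] equals [p (1 - p)]. A positive weight thus
    certifies that [logit] is evaluated inside [(0, 1)]. *)
Lemma kappa_gt0 x y y' : (0 < kappa pt x y y') = (0 < pt x y y' < 1).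
Proof.
rewrite /kappa /Defs.eta; move: (pt x y y') => p; case: (leP p (1 - p)) => hp.
  by rewrite pmulr_lgt0; [apply/idP/andP => [|[]//]; split|]; lra.
by rewrite subKr pmulr_lgt0; [apply/idP/andP => [|[]]; first split|]; lra.
Qed.

Lemma cycle_le_logit_error (delta : R) x y1 y2 y3 :
  0 < delta -> delta < 2^-1 ->
  3 * ell delta ^+ 2
    * (kappa_min pt x y1 y2 y3 * \1_(condorcet_cycles pt delta) (x, y1, y2, y3))
  <= logit_error x y1 y2 + logit_error x y2 y3 + logit_error x y3 y1.
Proof.
move=> d0 d1.
have rhs0 : 0 <= logit_error x y1 y2 + logit_error x y2 y3 + logit_error x y3 y1.
  by rewrite !addr_ge0// logit_error_ge0.
have l0 : 0 <= 3 * ell delta ^+ 2 by rewrite mulr_ge0// sqr_ge0.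
rewrite indicE; case: (boolP (_ \in _)) => /= [|_]; last by rewrite !mulr0.
rewrite inE mulr1 => CC.
(* A nonpositive weight makes the left side nonpositive. Otherwise all three weights are positive
   and the clipping is inactive. *)
have [k0|k0] := leP (kappa_min pt x y1 y2 y3) 0.
  by apply: le_trans rhs0; rewrite mulr_ge0_le0.
move: (k0); rewrite /kappa_min !lt_min => /and3P[k1 k2 k3].
have kE k : 0 < k -> Num.max k 0 = k by move=> /ltW ?; exact: max_l.
rewrite /logit_error !kE//.
apply: sum_sqr_cycle; rewrite /kappa_min ?ge_min ?lexx ?orbT//; first exact: ltW.
move: k1 k2 k3; rewrite !kappa_gt0 => p1 p2 p3.
have ed := ell_logit d0 d1.
(* The reward gaps telescope around the cycle. *)
have -> : logit (pt x y1 y2) - gap r x y1 y2 + (logit (pt x y2 y3) - gap r x y2 y3)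
    + (logit (pt x y3 y1) - gap r x y3 y1) =
    logit (pt x y1 y2) + logit (pt x y2 y3) + logit (pt x y3 y1).
  by rewrite /gap; ring.
have ell0 : 0 <= ell delta.
  by rewrite ed -logit_half le_logit ?inE//; lra.
have lP p : 0 < p < 1 -> 2^-1 + delta <= p -> ell delta <= logit p.
  by move=> p01 dp; rewrite ed le_logit// inE; lra.
(* Mirror image of [lP] under [p] to [1 - p], which changes the sign of [logit]. *)
have lN p : 0 < p < 1 -> p <= 2^-1 - delta -> logit p <= - ell delta.
  move=> p01 dp; rewrite ed -logitN le_logit ?inE//; first lra.
  by apply: le_trans dp _; lra.
case: CC => -[/= h1 h2 h3].
  have := lP _ p1 h1; have := lP _ p2 h2; have := lP _ p3 h3 => e3 e2 e1.
  by rewrite lerXn2r ?nnegrE//; lra.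
have := lN _ p1 h1; have := lN _ p2 h2; have := lN _ p3 h3 => e3 e2 e1.
by rewrite -[leRHS]sqrrN lerXn2r ?nnegrE//; lra.
Qed.

End Pointwise.

(** * Measurability of the integrands and the lower bound at a fixed prompt *)

Section Prompts.
Context {dX dY} {X : measurableType dX} {Y : measurableType dY} {R : realType}.
Variables (nu : probability X R) (mu : R.-pker X ~> Y).
Variables (n : nat) (n_ge1 : (1 <= n)%N) (u : 'I_n -> X * Y -> R).
Hypothesis u_meas : forall i, measurable_fun [set: X * Y] (u i).

(** Strictness on both sides comes from the single annotator [i0], which exists because [1 <= n];
    the others contribute weak inequalities. *)
Lemma pbar_itv01 x y y' : 0 < pbar u x y y' < 1.
Proof.
have n0 : 0 < n%:R :> R by rewrite ltr0n.
have i0 : 'I_n by exact: Ordinal n_ge1.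
rewrite /pbar; apply/andP; split.
  rewrite mulr_gt0 ?invr_gt0// (bigD1 i0)//= ltr_pwDl ?logistic_gt0//.
  by apply: sumr_ge0 => i _; exact/ltW/logistic_gt0.
rewrite ltr_pdivrMl// mulr1.
have -> : n%:R = \sum_(i < n) 1 :> R by rewrite sumr_const card_ord.
rewrite (bigD1 i0)//= [ltRHS](bigD1 i0)//= ltr_leD ?logistic_lt1//.
by apply: ler_sum => i _; exact/ltW/logistic_lt1.
Qed.

Lemma measurable_logistic : measurable_fun [set: R] (@logistic R).
Proof.
apply: continuous_measurable_fun => t.
have [dF _] := is_derive_logistic t.
exact/differentiable_continuous/derivable1_diffP.
Qed.

Lemma measurable_gap (r : X * Y -> R) : measurable_fun [set: X * Y] r ->
  measurable_fun [set: X * Y * Y] (fun t => gap r t.1.1 t.1.2 t.2).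
Proof.
move=> mr; apply: measurable_funB; apply: measurableT_comp => //.
  by apply: measurable_fun_pair; exact: measurableT_comp.
by apply: measurable_fun_pair => //; exact: measurableT_comp.
Qed.

Lemma measurable_pbar :
  measurable_fun [set: X * Y * Y] (fun t => pbar u t.1.1 t.1.2 t.2).
Proof.
apply: measurable_funM => //; apply: measurable_sum => i.
exact: (measurableT_comp measurable_logistic (measurable_gap (u_meas i))).
Qed.

Lemma measurable_cross_entropy d (T : measurableType d) (p q : T -> R) :
  measurable_fun [set: T] p -> measurable_fun [set: T] q ->
  measurable_fun [set: T] (fun t => cross_entropy (p t) (q t)).
Proof.
move=> mp mq; apply: measurable_funB; apply: measurable_funM.
- exact: measurable_funN.
- exact: (measurableT_comp (@measurable_ln R)).
- exact: measurable_funB.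
- by apply: (measurableT_comp (@measurable_ln R)); exact: measurable_funB.
Qed.

Lemma measurable_logit d (T : measurableType d) (p : T -> R) :
  measurable_fun [set: T] p -> measurable_fun [set: T] (fun t => logit (p t)).
Proof.
move=> mp; apply: measurable_funB; apply: (measurableT_comp (@measurable_ln R)) => //.
exact: measurable_funB.
Qed.

Lemma measurable_logit_error (pt : X -> Y -> Y -> R) (r : X * Y -> R) :
  measurable_fun [set: X * Y * Y] (fun t => pt t.1.1 t.1.2 t.2) ->
  measurable_fun [set: X * Y] r ->
  measurable_fun [set: X * Y * Y] (fun t => logit_error pt r t.1.1 t.1.2 t.2).
Proof.
move=> mpt mr.
have meta : measurable_fun [set: X * Y * Y] (fun t => Defs.eta pt t.1.1 t.1.2 t.2).
  by apply: measurable_minr => //; exact: measurable_funB.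
apply: measurable_funM.
  apply: measurable_maxr => //; apply: measurable_funM => //.
  exact: measurable_funB.
apply: measurable_funX; apply: measurable_funB; last exact: measurable_gap.
exact: measurable_logit.
Qed.

Lemma measurable_fix_prompt d (S : measurableType d) (f : X * Y * Y -> S) x :
  measurable_fun [set: X * Y * Y] f ->
  measurable_fun [set: Y * Y] (fun z => f (x, z.1, z.2)).
Proof.
move=> mf; apply: measurableT_comp => //; apply: measurable_fun_pair => //.
exact: measurable_fun_pair.
Qed.

Variables (d : nat) (phi : X * Y -> d.-tuple R).
Hypothesis phi_meas : measurable_fun [set: X * Y] phi.
Variable pt : X -> Y -> Y -> R.
Hypothesis ptP : is_ptilde mu phi u pt.
Variable r : X * Y -> R.
Hypothesis rP : feasible phi pt r.

Lemma feasible_measurable : measurable_fun [set: X * Y] r.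
Proof.
have [g [mg rE _]] := rP.
rewrite (_ : r = g \o phi); first exact: measurableT_comp.
by apply/funext => -[x y] /=.
Qed.

Local Open Scope ereal_scope.

(** The pointwise bound is integrated with [h = logit pt - gap r]. As [h] is measurable for the
    sigma-algebra of the embedded pair, the cross term disappears by
    [le_integral_cond_expectation]. *)
Lemma prompt_loss_lower_bound (x : X) :
  \int[response2 mu x]_z (cross_entropy (pbar u x z.1 z.2) (pbar u x z.1 z.2)
    + 2 * (pbar u x z.1 z.2 - pt x z.1 z.2) ^+ 2
    + 2^-1 * logit_error pt r x z.1 z.2)%:E
  <= \int[response2 mu x]_z
    (cross_entropy (pbar u x z.1 z.2) (logistic (gap r x z.1 z.2)))%:E.
Proof.
have [mpt cpt] := ptP; have [g [mg rE eta_gap]] := rP.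
have mr := feasible_measurable.
pose Z (z : Y * Y) := (phi (x, z.1), phi (x, z.2)).
have mphi : measurable_fun [set: Y] (fun y => phi (x, y)).
  by apply: measurableT_comp => //; exact: measurable_fun_pair.
have mZ : measurable_fun [set: Y * Y] Z.
  by apply: measurable_fun_pair; exact: (measurableT_comp mphi).
have ZG : measurable_fun [set: g_sigma_algebra_preimageType Z] Z.
  by move=> _ B mB; exists B.
have mpb : measurable_fun [set: Y * Y] (fun z => pbar u x z.1 z.2).
  exact: (measurable_fix_prompt x measurable_pbar).
have mptx : measurable_fun [set: Y * Y] (fun z => pt x z.1 z.2).
  exact: (measurable_fix_prompt x mpt).
have mgap : measurable_fun [set: Y * Y] (fun z => gap r x z.1 z.2).
  exact: (measurable_fix_prompt x (measurable_gap mr)).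
have mle : measurable_fun [set: Y * Y] (fun z => logit_error pt r x z.1 z.2).
  exact: (measurable_fix_prompt x (measurable_logit_error mpt mr)).
have [mptG _ _] := cpt x.
have ce0 y y' q : (0 < q < 1)%R -> (0 <= cross_entropy (pbar u x y y') q)%R.
  move=> q01; apply: cross_entropy_ge0 => //.
  by have /andP[p0 p1] := pbar_itv01 x y y'; rewrite !ltW.
apply: (le_integral_cond_expectation mZ mpb (fun z => pbar_itv01 x z.1 z.2)
  (cpt x) (h := fun z => logit (pt x z.1 z.2) - gap r x z.1 z.2)%R).
- apply: measurable_funD; last exact: measurable_funM.
  apply: measurable_funD; first exact: measurable_cross_entropy.
  by apply: measurable_funM => //; apply: measurable_funX; exact: measurable_funB.
- apply: measurable_cross_entropy => //.
  exact: (measurableT_comp measurable_logistic).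
- apply: measurable_funB; first exact: measurable_logit.
  (* Feasibility makes the reward gap a measurable function of [Z]. *)
  rewrite (_ : (fun z => _) = (fun z => g (Z z).1 - g (Z z).2)%R); last first.
    by apply/funext => z; rewrite /gap !rE.
  by apply: measurable_funB; apply: (measurableT_comp mg);
    apply: (measurableT_comp _ ZG).
- move=> z; apply: addr_ge0; last by rewrite mulr_ge0// ?invr_ge0// logit_error_ge0.
  apply: addr_ge0; first by apply: ce0; exact: pbar_itv01.
  by rewrite mulr_ge0// sqr_ge0.
- by move=> z; apply: ce0; rewrite logistic_gt0 logistic_lt1.
- move=> z p01; rewrite /logit_error.
  have kE : Num.max (kappa pt x z.1 z.2) 0%R = kappa pt x z.1 z.2.
    by apply/max_l/ltW; rewrite kappa_gt0.
  rewrite kE.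
  apply: le_trans (loss_gap_lower_bound (pbar_itv01 x z.1 z.2) p01 _).
    by rewrite /kappa /Defs.eta; lra.
  by have := eta_gap x z.1 z.2; rewrite /gap !rE.
Qed.

End Prompts.

(** * Averaging over prompts and collecting the constants *)

Theorem theorem4p1 (R : realType) (dX dY : measure_display)
    (X : measurableType dX) (Y : measurableType dY)
    (nu : probability X R) (mu : R.-pker X ~> Y)
    (n : nat) (n_ge1 : (1 <= n)%N)
    (u : 'I_n -> X * Y -> R)
    (u_meas : forall i, measurable_fun [set: X * Y] (u i))
    (d : nat) (phi : X * Y -> d.-tuple R)
    (phi_meas : measurable_fun [set: X * Y] phi)
    (pt : X -> Y -> Y -> R) (ptP : is_ptilde mu phi u pt)
    (r : X * Y -> R) (rP : feasible phi pt r)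
    (delta : R) (delta_gt0 : 0 < delta) (delta_lt : delta < 2^-1) :
  [/\ forall t : R, logistic t = 2^-1 + delta <-> t = ell delta,
      0 < ell delta &
      (2%:E * embedding_error nu mu pt u
         + (ell delta ^+ 2 / 2)%:E * cycle_mass nu mu pt delta
       <= loss nu mu u r - bayes_loss nu mu u)%E ].
Proof.
have [mpt _] := ptP; have mr := feasible_measurable phi_meas rP.
have ell_gt0 : 0 < ell delta.
  rewrite /ell ln_gt0// ltr_pdivlMr; lra.
split => //.
  move=> t; have d01 : 0 < 2^-1 + delta < 1 by lra.
  rewrite ell_logit//; split => [<-|->]; first by rewrite logisticK.
  by rewrite logitK.
pose I2 f x := (\int[response2 mu x]_z (f x z.1 z.2)%:E)%E.
pose H x y y' := cross_entropy (pbar u x y y') (pbar u x y y').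
pose S x y y' := (pbar u x y y' - pt x y y') ^+ 2.
pose T := logit_error pt r.
pose meas3 (f : X -> Y -> Y -> R) :=
  measurable_fun [set: X * Y * Y] (fun t => f t.1.1 t.1.2 t.2).
have mI2 f : meas3 f -> (forall x y y', 0 <= f x y y') ->
    measurable_fun [set: X] (I2 f).
  move=> mf f0; apply: (measurable_integral_response2 mu
    (f := fun t => (f t.1.1 t.1.2 t.2)%:E)) => //; last by move=> t; rewrite lee_fin.
  exact/measurable_EFinP.
have m2 (f : X -> Y -> Y -> R) x : meas3 f ->
    measurable_fun [set: Y * Y] (fun z => (f x z.1 z.2)%:E).
  by move=> mf; apply/measurable_EFinP; exact: (measurable_fix_prompt x mf).
have I20 f x : (forall x y y', 0 <= f x y y') -> (0 <= I2 f x)%E.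
  by move=> f0; apply: integral_ge0 => z _; rewrite lee_fin.
have p01 := pbar_itv01 n_ge1 u.
have mpb := measurable_pbar u_meas.
have mH : meas3 H by exact: measurable_cross_entropy.
have H0 x y y' : 0 <= H x y y'.
  apply: cross_entropy_ge0 (p01 x y y').
  by have /andP[/ltW -> /ltW ->] := p01 x y y'.
have mS : meas3 S by apply: measurable_funX; exact: measurable_funB.
have S0 x y y' : 0 <= S x y y' by exact: sqr_ge0.
have mT : meas3 T by exact: measurable_logit_error.
have T0 x y y' : 0 <= T x y y' by exact: logit_error_ge0.
(* The loss may be infinite, but the Bayes loss averages binary entropies, which are at most [ln 2];
   it can therefore be moved across the inequality. *)
have bayes_fin : bayes_loss nu mu u \is a fin_num.
  rewrite ge0_fin_numE; last by apply: integral_ge0 => x _; exact: (I20 H).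
  have Hle x y y' : H x y y' <= - ln 2^-1.
    (* At [q = 1/2] the cross-entropy is [ln 2] whatever the target, so Pinsker's inequality bounds
       the entropy. *)
    have := @pinsker_bernoulli R (pbar u x y y') 2^-1 (p01 x y y').
    move=> /(_ _)/wrap[|]; first lra.
    have -> : cross_entropy (pbar u x y y') 2^-1 = - ln 2^-1.
      rewrite /cross_entropy (_ : 1 - 2^-1 = 2^-1 :> R); [ring|lra].
    have := sqr_ge0 (pbar u x y y' - 2^-1); rewrite /H; lra.
  apply: (@le_lt_trans _ _ (\int[nu]_x cst (- ln (2^-1 : R))%:E x)%E); last first.
    by rewrite integral_cst// [X in (_ * X)%E]probability_setT mule1 ltry.
  have ln0 : 0 <= - ln (2^-1 : R) by rewrite oppr_ge0 ln_le0//; lra.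
  apply: le_integral_ge0 => x; last by rewrite lee_fin.
  apply: (@le_trans _ _ (\int[response2 mu x]_z cst (- ln (2^-1 : R))%:E z)%E).
    apply: le_integral_ge0 => z; rewrite lee_fin//; exact: Hle.
  by rewrite integral_cst// [X in (_ * X)%E]probability_setT mule1.
rewrite leeBrDr//.
(* Averaged over triples, the three pairs of a cycle give three copies of the integral of [T]; this
   3 cancels the one in [3 * ell delta ^+ 2]. *)
have cycleE : (cycle_mass nu mu pt delta <=
    (ell delta ^+ 2)^-1%:E * \int[nu]_x I2 T x)%E.
  have c0 : 0 <= (ell delta ^+ 2)^-1 by rewrite invr_ge0 sqr_ge0.
  have c30 : 0 <= (3 * ell delta ^+ 2)^-1 by rewrite invr_ge0 mulr_ge0// sqr_ge0.
  rewrite -ge0_integralZl//; last 2 first.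
  - exact: mI2.
  - by move=> x _; exact: I20.
  apply: le_integral_ge0 => x; last by rewrite mule_ge0 ?lee_fin// I20.
  pose q (z : Y * Y) := (T x z.1 z.2)%:E.
  have mq : measurable_fun [set: Y * Y] q by exact: m2.
  have q0 z : (0 <= q z)%E by rewrite lee_fin.
  apply: (@le_trans _ _ (\int[response3 mu x]_w
    ((3 * ell delta ^+ 2)^-1%:E * (q w.1 + q (w.1.2, w.2) + q (w.2, w.1.1))))%E).
    apply: le_integral_ge0 => w; last first.
      apply: mule_ge0; first by rewrite lee_fin.
      by apply: adde_ge0 => //; exact: adde_ge0.
    rewrite /q -!EFinD -EFinM lee_fin ler_pdivlMl; last first.
      by rewrite mulr_gt0// exprn_gt0.
    exact: cycle_le_logit_error.
  rewrite ge0_integralZl//; last 2 first.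
  - apply: emeasurable_funD; first apply: emeasurable_funD.
    + exact: measurableT_comp.
    + apply: measurableT_comp => //; apply: measurable_fun_pair => //.
      exact: measurableT_comp.
    + apply: measurableT_comp => //; apply: measurable_fun_pair => //.
      exact: measurableT_comp.
  - by move=> w _; apply: adde_ge0 => //; exact: adde_ge0.
  rewrite integral_cycle_pairs// muleA -EFinM.
  rewrite (_ : (3 * ell delta ^+ 2)^-1 * 3 = (ell delta ^+ 2)^-1)//.
  by field; rewrite gt_eqF.
(* The remaining factor [1/2] is the weight of [logit_error] in [prompt_loss_lower_bound]. *)
have {cycleE} : ((ell delta ^+ 2 / 2)%:E * cycle_mass nu mu pt delta <=
    2^-1%:E * \int[nu]_x I2 T x)%E.
  apply: (@le_trans _ _ ((ell delta ^+ 2 / 2)%:E *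
      ((ell delta ^+ 2)^-1%:E * \int[nu]_x I2 T x))%E).
    by rewrite lee_wpmul2l// lee_fin divr_ge0// sqr_ge0.
  rewrite muleA -EFinM (_ : _ / 2 * _ = 2^-1)//.
  by field; rewrite gt_eqF.
have mI2H := mI2 H mH H0; have mI2S := mI2 S mS S0; have mI2T := mI2 T mT T0.
have half0 : (0 <= 2^-1%:E :> \bar R)%E by rewrite lee_fin invr_ge0.
have two0 : (0 <= 2%:E :> \bar R)%E by rewrite lee_fin.
(* The cycle term is replaced by its upper bound; the other terms are then gathered under one
   integral over [nu], to be compared with the loss prompt by prompt. *)
move=> /(leeD2l (2%:E * embedding_error nu mu pt u)%E)/(leeD2r (bayes_loss nu mu u)).
move=> /le_trans; apply.
have -> : (2%:E * embedding_error nu mu pt u = \int[nu]_x (2%:E * I2 S x))%E.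
  by rewrite ge0_integralZl// => x _; exact: I20.
have -> : (2^-1%:E * \int[nu]_x I2 T x = \int[nu]_x (2^-1%:E * I2 T x))%E.
  by rewrite ge0_integralZl// => x _; exact: I20.
have mSx : measurable_fun [set: X] (fun x => 2%:E * I2 S x)%E.
  exact: measurable_funeM.
have mTx : measurable_fun [set: X] (fun x => 2^-1%:E * I2 T x)%E.
  exact: measurable_funeM.
rewrite -ge0_integralD//; last 2 first.
- by move=> x _; rewrite mule_ge0// I20.
- by move=> x _; rewrite mule_ge0// I20.
rewrite -ge0_integralD//; last 3 first.
- by move=> x _; rewrite adde_ge0// mule_ge0// I20.
- exact: emeasurable_funD.
- by move=> x _; exact: (I20 H).
apply: le_integral_ge0 => x; last first.
  apply: integral_ge0 => z _; rewrite lee_fin; apply: cross_entropy_ge0.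
    by have /andP[/ltW -> /ltW ->] := p01 x z.1 z.2.
  by rewrite logistic_gt0 logistic_lt1.
apply: le_trans (prompt_loss_lower_bound n_ge1 u_meas phi_meas ptP rP x).
(* The two sides are equal by additivity of the integral on nonnegative functions. *)
rewrite le_eqVlt; apply/orP; left; apply/eqP.
rewrite /I2 -!ge0_integralZl//; try exact: m2; try by move=> z _; rewrite lee_fin.
have mE (f : X -> Y -> Y -> R) c : meas3 f ->
    measurable_fun [set: Y * Y] (fun z => c%:E * (f x z.1 z.2)%:E)%E.
  by move=> mf; apply: measurable_funeM; exact: m2.
have E0 (f : X -> Y -> Y -> R) c z : 0 <= c -> (forall x y y', 0 <= f x y y') ->
    (0 <= c%:E * (f x z.1 z.2)%:E)%E.
  by move=> c0 f0; rewrite -EFinM lee_fin mulr_ge0.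
rewrite -ge0_integralD//; last 4 first.
- by move=> z _; apply: E0.
- exact: mE.
- by move=> z _; apply: E0 => //; rewrite invr_ge0.
- exact: mE.
rewrite -ge0_integralD//; last 4 first.
- by move=> z _; apply: adde_ge0; apply: E0 => //; rewrite invr_ge0.
- by apply: emeasurable_funD; exact: mE.
- by move=> z _; rewrite lee_fin; exact: H0.
- exact: (m2 H).
apply: eq_integral => z _; rewrite -!EFinM -!EFinD; congr EFin.
by rewrite /H /S /T; ring.
Qed.
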